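(* Let $(G_n)$ be a sequence of finite connected graphs, where $G_n$ has $n$ vertices, such that $g(n)=\dfrac{C(G_n)}{h_{\max}(G_n)}\to\infty$. Let $k=k(n)\ge1$ be integers with $k\le O(g(n)^{1-\epsilon})$ for some constant $0<\epsilon<1$. Then, as $n\to\infty$, $$C^{k}(G_n)=\frac{C(G_n)}{k}+o\!\left(\frac{C(G_n)}{k}\right),\qquad\text{and}\qquad S^{k}(G_n)\ge k-o(k).$$
   Context: A simple random walk on a finite graph moves at each step from the current vertex to a uniformly random neighbor. For a finite connected graph $G$, a vertex $i$ and an integer $k\ge 1$, let $\tau_i^k$ be the first time by which every vertex of $G$ has been visited by at least one of $k$ independent simple random walks, all started at $i$ at time $0$ and moving simultaneously (the vertex occupied at time $0$ counts as visited). Put $C_i^k=E[\tau_i^k]$, $C^k(G)=\max_i C_i^k$, and $C(G)=C^1(G)$ (the cover time). The speed-up is $S^k(G)=C(G)/C^k(G)$. The hitting time $h(u,v)$ is the expected time for a simple random walk started at $u$ to first reach $v$, and $h_{\max}(G)=\max_{u,v}h(u,v)$. Here $f(n)=o(q(n))$ means $f(n)/q(n)\to0$ as $n\to\infty$. *)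

(* Defs.v *)
From HB Require Import structures.
From mathcomp Require Import all_boot all_order all_algebra.
From mathcomp Require Import all_classical all_reals all_analysis.
From mathcomp Require Import measurable_realfun lra.

Set Implicit Arguments.
Unset Strict Implicit.
Unset Printing Implicit Defensive.

Import Order.TTheory GRing.Theory Num.Theory.
Import numFieldNormedType.Exports.

Local Open Scope classical_set_scope.
Local Open Scope ring_scope.

Record sgraph := SGraph {
  vertex :> finType;
  adj : rel vertex;
  adj_sym : symmetric adj;
  adj_irrefl : irreflexive adj }.

Definition connected_graph (G : sgraph) : Prop :=
  forall x y : G, fingraph.connect (@adj G) x y.

Definition deg (G : sgraph) (x : G) : nat := #|[pred y | adj x y]|.

(* A walk at an isolated vertex stays there; in a connected graph this
   concerns only the one-vertex graph, where no neighbor is available. *)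
Definition step_prob (R : realType) (G : sgraph) (x y : G) : R :=
  if deg x == 0%N then (x == y)%:R else (adj x y)%:R / (deg x)%:R.

Section Walks.
Context {R : realType} (G : sgraph) {d : measure_display}
        {Omega : measurableType d} (P : probability Omega R).

Definition follows (X : nat -> Omega -> G) (w : nat -> G) (t : nat) :
    set Omega :=
  [set o | forall s, (s <= t)%N -> X s o = w s].

(* The last clause is the product form of: conditionally on the trajectory up
   to time t, the position at time t + 1 has law step_prob (w t). *)
Definition simple_random_walk (X : nat -> Omega -> G) (i : G) : Prop :=
  [/\ forall t v, measurable (X t @^-1` [set v]),
      P (X 0%N @^-1` [set i]) = 1%E &
      forall (w : nat -> G) (t : nat),
        P (follows X w t.+1) =
          (P (follows X w t) * (step_prob R (w t) (w t.+1))%:E)%E].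

(* The trajectories up to a given time take finitely many values, so their
   independence is the product rule on point events. *)
Definition independent_walks k (X : 'I_k -> nat -> Omega -> G) : Prop :=
  forall (w : 'I_k -> nat -> G) (t : nat),
    P (\bigcap_(j in [set: 'I_k]) follows (X j) (w j) t) =
      (\prod_(j < k) P (follows (X j) (w j) t))%E.

End Walks.

Record kwalks (R : realType) (G : sgraph) (k : nat) (i : G) := KWalks {
  kw_disp : measure_display;
  kw_space : measurableType kw_disp;
  kw_prob : probability kw_space R;
  kw_pos : 'I_k -> nat -> kw_space -> G;
  kw_srw : forall j, simple_random_walk kw_prob (kw_pos j) i;
  kw_indep : independent_walks kw_prob kw_pos }.

Arguments kw_pos {R G k i} W _ _ _ : rename.

Section Times.
Context {R : realType} {G : sgraph}.

Definition first_time (p : nat -> Prop) : \bar R :=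
  ereal_inf [set t%:R%:E | t in [set t | p t]].

Definition covered k (i : G) (W : kwalks R k i) (o : kw_space W) (t : nat) :
    Prop :=
  forall v : G, exists j s, (s <= t)%N /\ kw_pos W j s o = v.

Definition expected_cover_time k (i : G) (W : kwalks R k i) : \bar R :=
  (\int[kw_prob W]_o first_time (covered o))%E.

Definition hitting_time (i : G) (W : kwalks R 1 i) (v : G) : \bar R :=
  (\int[kw_prob W]_o first_time (fun t => kw_pos W ord0 t o = v))%E.

(* W fixes, for every k and i, a realization of k independent walks from i
   (one exists, see kwalks_inhabited); the quantities below depend only on the
   laws of the walks. The maxima are over nonnegative extended reals, all of
   them finite when G is connected. *)
Definition cover_time (W : forall k (i : G), kwalks R k i)
    (k : nat) : R :=
  fine (\big[maxe/0%E]_(i : G) expected_cover_time (W k i)).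

Definition max_hitting_time (W : forall k (i : G), kwalks R k i) : R :=
  fine (\big[maxe/0%E]_(u : G) \big[maxe/0%E]_(v : G) hitting_time (W 1%N u) v).

Definition speedup (W : forall k (i : G), kwalks R k i)
    (k : nat) : R :=
  cover_time W 1 / cover_time W k.

End Times.

Definition little_o (R : realType) (f q : nat -> R) : Prop :=
  f n / q n @[n --> \oo] --> (0 : R).

(* Realizations exist on [0, 1] with the uniform probability: a chain that
   chooses uniformly in a list of d states moves to the state of index
   floor (d * u) and goes on with the fractional part of d * u, so that the
   points following a given path form an interval whose length is the
   probability of that path. *)
Section UniformChain.
Variables (R : realType) (S : finType) (nb : S -> seq S).
Hypothesis nb_uniq : forall s, uniq (nb s).
Hypothesis nb_gt0 : forall s, (0 < size (nb s))%N.

Fixpoint orbit_pos (t : nat) (s : S) (u : R) : S :=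
  if t is t'.+1 then
    let y := (size (nb s))%:R * u in
    let m := Num.truncn y in
    orbit_pos t' (nth s (nb s) m) (y - m%:R)
  else s.

Definition path_weight (w : nat -> S) (t : nat) : R :=
  \prod_(0 <= r < t) if w r.+1 \in nb (w r) then (size (nb (w r)))%:R^-1 else 0.

Lemma orbit_itv t (w : nat -> S) : exists a, [/\ 0 <= a,
  0 <= path_weight w t, a + path_weight w t <= 1 &
  forall u, 0 <= u < 1 ->
  ((forall s, (s <= t)%N -> orbit_pos s (w 0%N) u = w s) <->
   a <= u < a + path_weight w t)].
Proof.
elim: t w => [|t IH] w.
  exists 0; rewrite /path_weight big_geq //; split=> //; rewrite ?add0r ?ler01 //.
  by move=> u hu; rewrite hu; split=> [_ //|_ s]; rewrite leqn0 => /eqP ->.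
have -> : path_weight w t.+1 = (if w 1%N \in nb (w 0%N)
  then (size (nb (w 0%N)))%:R^-1 else 0) * path_weight (fun s => w s.+1) t.
  by rewrite /path_weight big_nat_recl.
have [a [a0 L0 aL H]] := IH (fun s => w s.+1).
set L := path_weight _ _ in L0 aL H *.
set d : R := (size (nb (w 0%N)))%:R.
have d0 : 0 < d by rewrite ltr0n.
have trE u : 0 <= u < 1 ->
    [/\ (Num.truncn (d * u) < size (nb (w 0%N)))%N,
        (Num.truncn (d * u))%:R <= d * u &
        d * u < (Num.truncn (d * u))%:R + 1].
  move=> /andP[u0 u1]; have du0 : 0 <= d * u by rewrite mulr_ge0 // ltW.
  have /andP[h1 h2] := truncn_itv du0.
  rewrite natr1; split=> //; rewrite -(ltr_nat R); apply: le_lt_trans h1 _.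
  by rewrite -/d gtr_pMr.
have E u : 0 <= u < 1 ->
  (forall s, (s <= t.+1)%N -> orbit_pos s (w 0%N) u = w s) <->
  (nth (w 0%N) (nb (w 0%N)) (Num.truncn (d * u)) = w 1%N /\
   forall s, (s <= t)%N ->
     orbit_pos s (w 1%N) (d * u - (Num.truncn (d * u))%:R) = w s.+1).
  move=> hu; split=> [h|[h1 h2]].
    have h1 := h 1%N isT; rewrite /= -/d in h1; split=> // s st.
    by rewrite -(h s.+1) //= -/d h1.
  by case=> [//|s] /= st; rewrite -/d h1 h2.
case: ifPn => w1.
    set m := index (w 1%N) (nb (w 0%N)).
    have md : (m < size (nb (w 0%N)))%N by rewrite index_mem.
    have m1d : m%:R + 1 <= d by rewrite natr1 ler_nat.
    have m0 : 0 <= m%:R :> R by [].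
    exists ((m%:R + a) / d); split.
    - by rewrite divr_ge0 ?addr_ge0 // ltW.
    - by rewrite mulr_ge0 // invr_ge0 ltW.
    - rewrite (mulrC d^-1) -mulrDl ler_pdivrMr // mul1r -addrA; apply: le_trans m1d.
      by rewrite lerD2l.
    move=> u hu; rewrite E //.
    have [T1 T2 T3] := trE _ hu.
    rewrite (mulrC d^-1) -mulrDl ler_pdivrMr // ltr_pdivlMr // (mulrC u d).
    split=> [[h1 h2]|/andP[h1 h2]].
      have mE : Num.truncn (d * u) = m by rewrite /m -h1 index_uniq.
      rewrite mE in T2 T3 h2.
      have /H [h _] : 0 <= d * u - m%:R < 1 by apply/andP; split; lra.
      by have /andP[k1 k2] := h h2; apply/andP; split; lra.
    have mE : Num.truncn (d * u) = m.
      by apply: truncn_def; rewrite -natr1; apply/andP; split; lra.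
    rewrite mE; split; first by rewrite nth_index.
    rewrite mE in T2 T3.
    have /H [_ h] : 0 <= d * u - m%:R < 1 by apply/andP; split; lra.
    by apply: h; apply/andP; split; lra.
  exists 0; rewrite mul0r addr0; split=> //.
  move=> u hu; rewrite E //; have [T1 _ _] := trE _ hu; split.
    by move=> [h _]; move: w1; rewrite -h mem_nth.
  by move=> h; exfalso; lra.
Qed.


Let P : probability _ R := uniform_prob (@ltr01 R).

Lemma uniform_itv (a b : R) : 0 <= a -> a <= b -> b <= 1 ->
  P `[a, b[%classic = (b - a)%:E.
Proof.
move=> a0 ab b1.
have -> : P `[a, b[%classic = (\int[P]_x (\1_(`[a, b[%classic : set R) x)%:E)%E.
  by rewrite integral_indic // setIT.
rewrite /P integral_uniform //=; last first.
  exact/measurable_EFinP/measurable_indic.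
rewrite subr0 invr1 mul1e integral_indic //= setIidl; last first.
  move=> x; rewrite /= !in_itv /= => /andP[h1 h2].
  by apply/andP; split; lra.
rewrite lebesgue_measure_itv /= lte_fin; case: ltgtP ab => // -> _.
by rewrite subrr.
Qed.

Variable s0 : S.

Definition chain_pos (t : nat) (u : R) : S :=
  orbit_pos t s0 (if 0 <= u < 1 then u else 0).

Definition chain_path (w : nat -> S) (t : nat) : set R :=
  [set u | forall s, (s <= t)%N -> chain_pos s u = w s].

Lemma chain_law w t : measurable (chain_path w t) /\
  P (chain_path w t) = ((w 0%N == s0)%:R * path_weight w t)%:E.
Proof.
case: eqP => [w0|w0]; last first.
  have -> : chain_path w t = set0.
    by apply/seteqP; split=> // u /= /(_ 0%N isT) /esym.
  by rewrite measure0 mul0r; split.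
have [a [a0 L0 aL H]] := orbit_itv t w.
set L := path_weight w t in L0 aL H *.
pose I : set R := `[0, 1[%classic.
pose B : set R := if (0 <= (0 : R) < 1) && (a <= 0 < a + L) then ~` I else set0.
have mI : measurable I by exact: measurable_itv.
have mB : measurable B by rewrite /B; case: ifP => _; [exact: measurableC|exact: measurable0].
have PI : P (~` I) = 0%E.
  rewrite probability_setC //.
  by rewrite uniform_itv ?subr0 ?subee // ?lexx ?ler01.
have PB : P B = 0%E by rewrite /B; case: ifP => // _; rewrite measure0.
have E : chain_path w t = `[a, (a + L)[%classic `|` B.
  apply/seteqP; split=> u; rewrite /chain_path /chain_pos /B /I /= -w0.
    case: ifPn => hu h.
      by left; rewrite /= in_itv /=; apply/(H _ hu).
    right; rewrite lexx ltr01 /=.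
    have h0 : 0 <= (0 : R) < 1 by rewrite lexx ltr01.
    have /(H _ h0) -> := h.
    by rewrite /= in_itv /=; apply/negP.
  case=> [|]; rewrite /= ?in_itv /=.
    move=> hu; have hu' : 0 <= u < 1.
      by move/andP: hu => [h1 h2]; apply/andP; split; lra.
    by rewrite hu'; apply/(H _ hu').
  case: ifPn => // /andP[h0 h1] /=; rewrite in_itv /= => /negP/negbTE ->.
  exact/(H _ h0).
have mE : measurable (chain_path w t).
  by rewrite E; apply: measurableU => //; exact: measurable_itv.
split=> //.
have -> : P (chain_path w t) = P `[a, (a + L)[%classic.
  have -> : P (chain_path w t) = P (`[a, (a + L)[%classic `|` B) by rewrite E.
  by apply: measureU0 => //; exact: measurable_itv.
by rewrite uniform_itv ?lerDl // mul1r addrC addKr.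
Qed.

End UniformChain.

Section Existence.
Variables (R : realType) (G : sgraph) (k : nat) (i : G).

Definition may_step (x y : G) : bool :=
  if deg x == 0%N then x == y else adj x y.

Lemma step_probE (x y : G) :
  step_prob R x y = if may_step x y then #|may_step x|%:R^-1 else 0.
Proof.
rewrite /step_prob /may_step; case: eqP => [d0|d0].
  case: eqP => // ->.
  have -> : #|[pred y0 | y == y0]| = 1%N.
    by rewrite -(card1 y); apply: eq_card => z; rewrite !inE eq_sym.
  by rewrite invr1.
case: ifP => h; last by rewrite mul0r.
by rewrite mul1r.
Qed.

Lemma may_step_gt0 x : (0 < #|may_step x|)%N.
Proof.
rewrite /may_step; case: eqP => [_|/eqP]; last by rewrite lt0n.
by apply/card_gt0P; exists x; rewrite unfold_in eqxx.
Qed.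

Let S := {ffun 'I_k -> G}.

Definition next_states (s : S) : seq S :=
  enum (family (fun j => may_step (s j) : pred G)).

Lemma size_next (s : S) : size (next_states s) = (\prod_j #|may_step (s j)|)%N.
Proof. by rewrite -cardE card_family foldrE big_map enumT. Qed.

Lemma next_gt0 s : (0 < size (next_states s))%N.
Proof. by rewrite size_next; apply: prodn_gt0 => j; exact: may_step_gt0. Qed.

Lemma next_uniq s : uniq (next_states s).
Proof. exact: enum_uniq. Qed.

Definition walk_weight (w : nat -> G) (t : nat) : R :=
  (w 0%N == i)%:R * \prod_(0 <= r < t) step_prob R (w r) (w r.+1).

Let X (j : 'I_k) t u : G :=
  chain_pos next_states ([ffun=> i] : S) t (u : R) j.

Let P : probability _ R := uniform_prob (@ltr01 R).

Let joint (w : 'I_k -> nat -> G) t : set R :=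
  [set u | forall j s, (s <= t)%N -> X j s u = w j s].

Lemma joint_law (w : 'I_k -> nat -> G) t : measurable (joint w t) /\
  P (joint w t) = (\prod_j walk_weight (w j) t)%:E.
Proof.
have [mE PE] := @chain_law R _ _ next_uniq next_gt0 [ffun=> i] (fun s => [ffun j => w j s]) t.
have <- : chain_path next_states [ffun=> i] (fun s => [ffun j => w j s]) t = joint w t.
  apply/seteqP; split=> u h.
    by move=> j s st; rewrite /X (h _ st) ffunE.
  by move=> s st; apply/ffunP => j; rewrite ffunE; exact: h.
split=> //; rewrite [LHS]PE; congr EFin; rewrite /walk_weight big_split /=.
congr (_ * _).
  rewrite -natr_prod; congr (_%:R)%R.
  case: eqP => [/ffunP h|h].
    by rewrite big1 // => j _; have := h j; rewrite !ffunE => ->; rewrite eqxx.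
  apply/esym/eqP; rewrite -leqn0 leqNgt; apply/negP => h'; apply: h.
  apply/ffunP => j; rewrite !ffunE; apply/eqP.
  by move: h'; rewrite (bigD1 j) //= muln_gt0 lt0b => /andP[].
rewrite /path_weight exchange_big /=; apply: eq_bigr => r _.
rewrite size_next mem_enum; case: ifPn => [/familyP h|/familyP h].
  rewrite natr_prod -prodfV; apply: eq_bigr => j _.
  by rewrite step_probE; have := h j; rewrite !ffunE -topredE /= => ->.
have [j hj] : exists j, ~~ may_step (w j r) (w j r.+1).
  apply/existsP; rewrite -negb_forall; apply/negP => /forallP h'.
  by apply: h => j; rewrite !ffunE; exact: h'.
by rewrite (bigD1 j) //= step_probE (negbTE hj) mul0r.
Qed.

Let T t := {ffun 'I_t.+1 -> G}.
Let ext t (f : T t) : nat -> G := fun s => f (inord s).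

Lemma walk_weight_ext t (f : T t) (w : nat -> G) :
  f = [ffun s => w (val s)] -> walk_weight (ext f) t = walk_weight w t.
Proof.
move=> ->; rewrite /walk_weight /ext !ffunE /= inordK //; congr (_ * _).
rewrite !big_mkord; apply: eq_bigr => r _.
have rt := ltn_ord r; by rewrite !ffunE /= !inordK // ltnS ltnW //.
Qed.

Lemma joint_sum t (A : {set {ffun 'I_k -> T t}}) :
  let E := [set u | [ffun j => [ffun s : 'I_t.+1 => X j s u]] \in A] in
  measurable E /\
  P E = (\sum_(g in A) \prod_j walk_weight (ext (g j)) t)%:E.
Proof.
move=> E.
have EE : E = \bigcup_(g in [set` enum A]) joint (fun j => ext (g j)) t.
  apply/seteqP; split=> u; rewrite /E /=.
    move=> h; exists [ffun j => [ffun s : 'I_t.+1 => X j s u]] => /=.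
      by rewrite mem_enum.
    by move=> j s st; rewrite /ext !ffunE inordK.
  case=> g; rewrite /= mem_enum => gA h; congr (_ \in A): gA.
  apply/ffunP => j; apply/ffunP => s; rewrite !ffunE h -1?ltnS //.
  by rewrite /ext inord_val.
have tE : trivIset [set` enum A] (fun g => joint (fun j => ext (g j)) t).
  move=> g g' _ _ [u [h h']]; apply/ffunP => j; apply/ffunP => s.
  have st : (s <= t)%N by rewrite -ltnS.
  by move: (h j s st); rewrite (h' j s st) /ext inord_val.
have mJ g : measurable (joint (fun j => ext (g j)) t) by case: (joint_law (fun j => ext (g j)) t).
rewrite EE; split; first exact: fin_bigcup_measurable.
rewrite measure_fin_bigcup; [|exact: finite_seq|by []|by move=> g _; exact: mJ].
rewrite -fsbig_seq ?enum_uniq // big_enum /= -sumEFin.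
by apply: eq_bigr => g _; case: (joint_law (fun j => ext (g j)) t).
Qed.

Lemma weight_sum1 t (j : 'I_k) : \sum_(f : T t) walk_weight (ext f) t = 1.
Proof.
have [_] := @joint_sum t [set: _]%SET.
have -> : [set u | [ffun j => [ffun s : 'I_t.+1 => X j s u]] \in [set: {ffun 'I_k -> T t}]%SET] = setT.
  by apply/seteqP; split=> // u _ /=; rewrite inE.
rewrite probability_setT; case=> /esym.
rewrite (eq_bigl xpredT) => [|g]; last by rewrite inE.
rewrite -(bigA_distr_bigA (fun _ f => walk_weight (ext f) t)) prodr_const card_ord => h.
apply/eqP; rewrite -(@pexpr_eq1 _ _ k) ?h ?eqxx //; first exact: leq_ltn_trans (ltn_ord j).
apply: sumr_ge0 => f _; rewrite mulr_ge0 // prodr_ge0 // => r _.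
by rewrite step_probE; case: ifP => // _; rewrite invr_ge0.
Qed.

Lemma single_law (j : 'I_k) w t :
  P (follows (X j) w t) = (walk_weight w t)%:E.
Proof.
pose f0 : T t := [ffun s => w (val s)].
have [_] := @joint_sum t [set g : {ffun 'I_k -> T t} | g j == f0]%SET.
have -> : [set u | [ffun j => [ffun s : 'I_t.+1 => X j s u]]
   \in [set g : {ffun 'I_k -> T t} | g j == f0]%SET] = follows (X j) w t.
  apply/seteqP; split=> u; rewrite /= inE ffunE.
    move/eqP/ffunP => h s st; have := h (Ordinal (st : s < t.+1)%N).
    by rewrite !ffunE.
  by move=> h; apply/eqP/ffunP => s; rewrite !ffunE h // -ltnS.
move=> ->; congr EFin.
pose Q l : pred (T t) := if l == j then pred1 f0 else predT.
rewrite (eq_bigl (fun g : {ffun 'I_k -> T t} => g \in family Q)); last first.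
  move=> g; rewrite inE; apply/eqP/familyP => [h l|/(_ j)].
    by rewrite /Q; case: eqP => [->|_] //; rewrite inE h.
  by rewrite /Q eqxx inE => /eqP.
rewrite -(bigA_distr_big_dep Q (fun _ f => walk_weight (ext f) t)) (bigD1 j) //=.
rewrite {1}/Q eqxx big_pred1_eq (walk_weight_ext (w := w)) // big1 ?mulr1 // => l lj.
by rewrite /Q (negbTE lj) weight_sum1.
Qed.

Lemma kwalks_inhabited : inhabited (kwalks R k i).
Proof.
constructor; apply: (@KWalks R G k i _ _ P X) => [j|w t].
  split=> [t v||w t].
  - have [+ _] := @joint_sum t [set g : {ffun 'I_k -> T t} | g j ord_max == v]%SET.
    congr measurable; apply/seteqP; split=> u; rewrite /= inE !ffunE.
      by move/eqP.
    by move/eqP.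
  - have -> : X j 0%N @^-1` [set i] = follows (X j) (fun=> i) 0.
      apply/seteqP; split=> u /=; last exact.
      by move=> h s; rewrite leqn0 => /eqP ->.
    by rewrite single_law /walk_weight eqxx big_geq // mulr1.
  - by rewrite !single_law /walk_weight big_nat_recr //= mulrA EFinM.
rewrite (eq_bigr (fun j => (walk_weight (w j) t)%:E)); last first.
  by move=> j _; rewrite single_law.
rewrite prodEFin; have [_ <-] := joint_law w t; congr (P _).
apply/seteqP; split=> u /= h; first by move=> j s st; exact: h.
by move=> j _ s st; exact: h.
Qed.
End Existence.

(* Main.v *)
(** Reading the k trajectories one after the other compares the k walks at time
    t with a single walk at time about k t: the only obstruction is that the
    pieces of the single walk do not all start at i. If every walk is given an
    additional margin of m steps in which it can reach the point where its
    piece should start, then, in both directions, the probabilities of not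
    having covered differ by at most k a_m, where a_m bounds the probability of
    missing a given vertex for m steps. By Markov's inequality at time 2 h_max
    and the Markov property, a_m decays like 2^-(m/m0) with m0 of order h_max.
    Summing over t, with a margin j m0 + t/L that grows slowly with t so that
    the errors are summable, and with 2^j >= k, gives
      |C^k - C/k| <= C/(kL) + O(L j h_max),
    and the last term is small compared with C/k as soon as k log k = o(C/h_max).
    No concentration of the cover time is needed. *)

Require Import Defs.
From mathcomp Require Import all_boot all_order all_algebra.
From mathcomp Require Import all_classical all_reals all_analysis.
From mathcomp Require Import measurable_realfun zify ring lra.

Set Implicit Arguments.
Unset Strict Implicit.

Import Order.TTheory GRing.Theory Num.Theory.
Import numFieldNormedType.Exports.

Local Open Scope classical_set_scope.
Local Open Scope ring_scope.

(** * Walks as operators on the set still to be visited *)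

Section Evolution.
Context {R : realType} {G : sgraph}.
Implicit Types (x y z : G) (A B : {set G}) (F : {set G} -> R).
Implicit Types (f g : G -> {set G} -> R) (t u m k : nat).

Local Notation p := (step_prob R).

Lemma step_prob_ge0 x y : 0 <= p x y.
Proof. by rewrite step_probE; case: ifP => // _; rewrite invr_ge0. Qed.

Lemma step_prob_sum x : \sum_y p x y = 1.
Proof.
rewrite (eq_bigr (fun y => if may_step x y then #|may_step x|%:R^-1 else 0)).
  rewrite -big_mkcond (sumr_const (may_step x)) -[LHS]mulr_natl.
  by rewrite mulfV // pnatr_eq0 -lt0n may_step_gt0.
by move=> y _; rewrite step_probE.
Qed.

Lemma step_prob_adj x y : adj x y -> 0 < p x y.
Proof.
move=> xy; rewrite /step_prob; have dx : (0 < deg x)%N by apply/card_gt0P; exists y.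
by rewrite (gtn_eqF dx) xy mul1r invr_gt0 ltr0n.
Qed.

(* [evolve t f x A] is the expectation of f at time t for the walk from x,
   where the second argument of f is A minus the vertices visited strictly
   before t. *)
Fixpoint evolve t f x A : R :=
  if t is t'.+1 then \sum_y p x y * evolve t' f y (A :\ x) else f x A.

(** [evolve] removes only what is visited strictly before the final time; this removes the final
    position too, so that [uncovered t] accounts for the times 0 to t inclusive. *)
Definition after F x A : R := F (A :\ x).

Definition pending A : R := (A != finset.set0)%:R.

Definition uncovered t x A : R := evolve t (after pending) x A.

(* The walks are run one after the other, each of them removing from A the
   vertices that it visits. *)
Fixpoint kuncovered k t i A : R :=
  if k is k'.+1 then evolve t (after (kuncovered k' t i)) i A else pending A.

Lemma le_evolve t f g x A :
  (forall y B, f y B <= g y B) -> evolve t f x A <= evolve t g x A.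
Proof.
move=> fg; elim: t x A => [|t IH] x A //=.
by apply: ler_sum => y _; rewrite ler_wpM2l ?step_prob_ge0.
Qed.

Lemma evolveDc t f c x A :
  evolve t (fun y B => f y B + c) x A = evolve t f x A + c.
Proof.
elim: t x A => [|t IH] x A //=.
rewrite (eq_bigr (fun y => p x y * evolve t f y (A :\ x) + p x y * c)).
  by rewrite big_split /= -mulr_suml step_prob_sum mul1r.
by move=> y _; rewrite IH mulrDr.
Qed.

Lemma evolve_cst t c x A : evolve t (fun _ _ => c) x A = c.
Proof. by elim: t x A => //= t IH x A; under eq_bigr do rewrite IH;
  rewrite -mulr_suml step_prob_sum mul1r. Qed.

Lemma evolveD t u f x A : evolve (t + u) f x A = evolve t (evolve u f) x A.
Proof. by elim: t x A => //= t IH x A; apply: eq_bigr => y _; rewrite IH. Qed.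

Lemma evolve_after_del t F x A :
  evolve t (after F) x (A :\ x) = evolve t (after F) x A.
Proof.
have E : (A :\ x) :\ x = A :\ x by apply/setP => y; rewrite !inE; case: eqP.
by case: t => [|t] /=; rewrite /after E.
Qed.

Definition monotone F := forall A B, A \subset B -> F A <= F B.

Lemma evolve_monotone t F x : monotone F -> monotone (evolve t (after F) x).
Proof.
move=> mF; elim: t x => [|t IH] x A B AB /=; first by apply: mF; exact: finset.setSD.
apply: ler_sum => y _; rewrite ler_wpM2l ?step_prob_ge0 //.
by apply: IH; exact: finset.setSD.
Qed.

Lemma pending_monotone : monotone pending.
Proof.
move=> A B AB; rewrite /pending ler_nat; case: (eqVneq B finset.set0) => [B0|_]; last exact: leq_b1.
by move: AB; rewrite B0 finset.subset0 => ->.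
Qed.

Definition prob_val F := forall A, 0 <= F A <= 1.

Lemma evolve_prob t F x : prob_val F -> prob_val (evolve t (after F) x).
Proof.
move=> pF A; apply/andP; split.
  rewrite -(evolve_cst t 0 x A); apply: le_evolve => y B.
  by case/andP: (pF (B :\ y)).
rewrite -[leRHS](evolve_cst t 1 x A); apply: le_evolve => y B.
by case/andP: (pF (B :\ y)).
Qed.

Lemma pending_prob : prob_val pending.
Proof. by move=> A; rewrite /pending; case: eqP; rewrite /= ?lexx ler01. Qed.

Lemma kuncovered_monotone k t i : monotone (kuncovered k t i).
Proof.
by elim: k => [|k IH] /=; [exact: pending_monotone|exact: evolve_monotone].
Qed.

Lemma kuncovered_prob k t i : prob_val (kuncovered k t i).
Proof. by elim: k => [|k IH] /=; [exact: pending_prob|exact: evolve_prob]. Qed.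

Lemma evolve_antitone F x A : monotone F ->
  {homo (fun t => evolve t (after F) x A) : t u / (t <= u)%N >-> u <= t}.
Proof.
move=> mF; apply: (@homo_leq _ _ (fun a b : R => b <= a)) => [a|a b c|t].
- exact: lexx.
- by move=> ba cb; exact: le_trans cb ba.
elim: t x A => [|t IH] x A; last first.
  by apply: ler_sum => y _; rewrite ler_wpM2l ?step_prob_ge0 //; exact: IH.
rewrite -[leRHS]mul1r -(step_prob_sum x) mulr_suml; apply: ler_sum => y _.
by rewrite ler_wpM2l ?step_prob_ge0 //; apply: mF; exact: finset.subsetDl.
Qed.

Lemma uncovered_prob t x : prob_val (uncovered t x).
Proof. exact/evolve_prob/pending_prob. Qed.

Lemma kuncovered_antitone k i A :
  {homo (fun t => kuncovered k t i A) : t u / (t <= u)%N >-> u <= t}.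
Proof.
move=> t u tu; elim: k A => [|k IH] A //=.
apply: (le_trans (evolve_antitone i A (kuncovered_monotone k u i) tu)).
by apply: le_evolve => y B; exact: IH.
Qed.

Lemma uncovered_antitone x A :
  {homo (fun t => uncovered t x A) : t u / (t <= u)%N >-> u <= t}.
Proof. exact/evolve_antitone/pending_monotone. Qed.

Lemma uncovered0 t x A : A :\ x = finset.set0 -> uncovered t x A = 0.
Proof.
rewrite /uncovered; elim: t x A => [|t IH] x A Ax /=.
  by rewrite /after /pending Ax eqxx.
by rewrite big1 // => y _; rewrite IH ?mulr0 // Ax finset.set0D.
Qed.

Lemma uncovered_hit t z : uncovered t z (finset.set1 z) = 0.
Proof. by apply: uncovered0; rewrite finset.setDv. Qed.

Lemma set1_del y z : y != z -> [set z]%SET :\ y = [set z]%SET.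
Proof.
move=> yz; apply/setP => v; rewrite !inE; case: (eqVneq v z) => [->|_];
  by rewrite ?andbF // eq_sym yz.
Qed.

(* Until the walk from y hits z nothing that it visits is counted; afterwards
   it is a walk from z. *)
Lemma evolve_restart m u F y z A : monotone F -> prob_val F ->
  evolve (m + u) (after F) y A <=
  evolve u (after F) z A + uncovered m y (finset.set1 z).
Proof.
move=> mF pF; elim: m y A => [|m IH] y A.
  case: (eqVneq y z) => [->|yz]; first by rewrite uncovered_hit addr0.
  (* At m = 0 with y other than z, the probability of missing z is 1 and alone dominates the left
     side. *)
  rewrite /uncovered /= /after /pending set1_del //.
  have -> : ([set z]%SET != finset.set0) by apply/set0Pn; exists z; rewrite inE.
  have /andP[_ h] := evolve_prob u y pF A; apply: le_trans h _.
  by rewrite lerDr; case/andP: (evolve_prob u z pF A).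
case: (eqVneq y z) => [->|yz].
  by rewrite uncovered_hit addr0; apply: evolve_antitone => //; exact: leq_addl.
rewrite /uncovered /= set1_del // -/(uncovered _ _ _).
apply: (@le_trans _ _ (\sum_x p y x * (evolve u (after F) z (A :\ y) +
   uncovered m x [set z]%SET))).
  by apply: ler_sum => x _; rewrite ler_wpM2l ?step_prob_ge0.
under [leLHS]eq_bigr do rewrite mulrDr.
rewrite big_split /= -mulr_suml step_prob_sum mul1r lerD2r.
by apply: evolve_monotone => //; exact: finset.subsetDl.
Qed.

(** Markov property after m steps: a walk that has missed z so far misses it for u more steps with
    probability at most a, wherever it stands. *)
Lemma hitD m u y z a :
  (forall x, uncovered u x (finset.set1 z) <= a) ->
  uncovered (m + u) y (finset.set1 z) <= uncovered m y (finset.set1 z) * a.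
Proof.
move=> ua; elim: m y => [|m IH] y.
  case: (eqVneq y z) => [->|yz]; first by rewrite !uncovered_hit mul0r.
  rewrite [uncovered 0 _ _]/uncovered /= /after /pending set1_del //.
  have -> : ([set z]%SET != finset.set0) by apply/set0Pn; exists z; rewrite inE.
  by rewrite mul1r.
case: (eqVneq y z) => [->|yz]; first by rewrite !uncovered_hit mul0r.
rewrite /uncovered /= set1_del // mulr_suml; apply: ler_sum => x _.
by rewrite -mulrA ler_wpM2l ?step_prob_ge0 //; exact: IH.
Qed.

(** Union bound over the missed vertices; it serves to show that the cover time is finite. *)
Lemma uncovered_union t x A :
  uncovered t x A <= \sum_(z in A) uncovered t x (finset.set1 z).
Proof.
elim: t x A => [|t IH] x A.
  rewrite /uncovered /= /after /pending.
  have [_|/set0Pn[z]] := eqVneq (A :\ x) finset.set0.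
    by apply: sumr_ge0 => z _; case: (_ != _).
  rewrite !inE eq_sym => /andP[xz zA]; rewrite (bigD1 z) //= set1_del //.
  have -> : ([set z]%SET != finset.set0) by apply/set0Pn; exists z; rewrite inE.
  by rewrite lerDl; apply: sumr_ge0 => v _; case: (_ != _).
rewrite /uncovered /=.
apply: (@le_trans _ _ (\sum_y p x y * \sum_(z in A :\ x) uncovered t y [set z]%SET)).
  by apply: ler_sum => y _; rewrite ler_wpM2l ?step_prob_ge0 //; exact: IH.
under [leLHS]eq_bigr do rewrite mulr_sumr.
rewrite exchange_big /=.
apply: (@le_trans _ _ (\sum_(z in A :\ x) uncovered t.+1 x [set z]%SET)).
  apply: ler_sum => z; rewrite !inE eq_sym => /andP[xz _].
  by rewrite /uncovered /= set1_del.
rewrite big_mkcond [leRHS]big_mkcond; apply: ler_sum => z _.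
rewrite !inE; case: (z \in A); rewrite ?andbF ?andbT //; case: ifP => // _.
by case/andP: (uncovered_prob t.+1 x [set z]%SET).
Qed.

(** Each of the k walks has m steps to reach the point z where the previous piece of the single walk
    ended, and then imitates its next u steps; a failure to reach z costs at most a. *)
Lemma kuncovered_le_uncovered k m u i A a : (0 < k)%N ->
  (forall x y, uncovered m x (finset.set1 y) <= a) ->
  kuncovered k (m + u) i A <= uncovered (k * u) i A + k%:R * a.
Proof.
move=> k0 ha.
(* The induction follows the current endpoint z of the single walk, deleted from [B] because it is
   already visited. *)
have H z B : kuncovered k (m + u) i (B :\ z) <= uncovered (k * u) z B + k%:R * a.
  elim: k z B {k0} => [|k IH] z B; first by rewrite mul0r addr0 mul0n.
  have /= h := evolve_restart m u i z (B :\ z) (kuncovered_monotone k (m + u) i)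
    (kuncovered_prob k (m + u) i).
  apply: le_trans h _; rewrite evolve_after_del mulSn /uncovered evolveD.
  rewrite -natr1 mulrDl mul1r addrA -[X in _ <= X + _]evolveDc lerD //; last exact: ha.
  by apply: le_evolve => y C; exact: IH.
(* For positive k the first walk itself visits i at time 0, so deleting i from [A] in advance
   changes nothing. *)
case: k k0 H => // k _ H.
by have := H i A; rewrite /= evolve_after_del.
Qed.

(** The roles are exchanged: before each piece the single walk gets m steps to reach i, from where
    it imitates u steps of the next of the k walks. *)
Lemma uncovered_le_kuncovered k m u i x A a :
  (forall x y, uncovered m x (finset.set1 y) <= a) ->
  uncovered (k * (m + u)) x A <= kuncovered k u i A + k%:R * a.
Proof.
move=> ha; elim: k x A => [|k IH] x A.
  by rewrite mul0r addr0 mul0n; apply: pending_monotone; exact: finset.subsetDl.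
rewrite mulSn -addnA.
have h := evolve_restart m (u + k * (m + u)) x i A pending_monotone pending_prob.
apply: le_trans h _; rewrite evolveD -natr1 mulrDl mul1r addrA lerD //.
rewrite -evolveDc; apply: le_evolve => y B.
rewrite -/(uncovered _ _ _) /uncovered -evolve_after_del; exact: IH.
Qed.

End Evolution.

(** * Block estimates for sums of decreasing sequences *)

Section BlockSums.
Context {R : realType}.
Implicit Types (f : nat -> R) (b Q : nat).

Lemma sum_cst_nat n (x : R) : \sum_(0 <= s < n) x = n%:R * x.
Proof. by rewrite sumr_const_nat subn0 mulr_natl. Qed.

Lemma sum_le_block f b Q : {homo f : t u / (t <= u)%N >-> u <= t} ->
  \sum_(0 <= s < b * Q) f s <= b%:R * \sum_(0 <= q < Q) f (b * q)%N.
Proof.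
move=> fh; elim: Q => [|Q IH]; first by rewrite muln0 !big_geq // mulr0.
rewrite mulnS addnC (big_cat_nat _ (leq_addr b _)) //= big_nat_recr //= mulrDr.
apply: lerD => //; rewrite -{1}[(b * Q)%N]add0n big_addn addKn.
rewrite -sum_cst_nat.
by apply: ler_sum_nat => s _; apply: fh; exact: leq_addl.
Qed.

Lemma block_le_sum f b Q : {homo f : t u / (t <= u)%N >-> u <= t} ->
  b%:R * \sum_(0 <= q < Q) f (b * q.+1)%N <= \sum_(0 <= s < b * Q) f s.
Proof.
move=> fh; elim: Q => [|Q IH]; first by rewrite muln0 !big_geq // mulr0.
rewrite [in leRHS]mulnS addnC (big_cat_nat _ (leq_addr b _)) //=.
rewrite big_nat_recr //= mulrDr.
apply: lerD => //; rewrite -{1}[(b * Q)%N]add0n big_addn addKn.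
rewrite -sum_cst_nat.
apply: ler_sum_nat => s /andP[_ sb]; apply: fh.
by rewrite mulnS leq_add2r ltnW.
Qed.

(** The offset contributes exactly the factor [2^-1 ^+ j]; what remains takes each power of 1/2 at
    most m0 times, which leaves a geometric sum. *)
Lemma half_geometric_sum (m0 j Q : nat) : (0 < m0)%N ->
  \sum_(0 <= q < Q) (2^-1 : R) ^+ ((j * m0 + q) %/ m0) <= 2^-1 ^+ j * (2 * m0%:R).
Proof.
move=> m00.
have hh : {homo (fun q => (2^-1 : R) ^+ (q %/ m0)) : t u / (t <= u)%N >-> u <= t}.
  move=> t u tu; apply: ler_wiXn2l; rewrite ?invr_ge0 ?ler0n //.
    by rewrite invf_le1 // ler1n.
  exact: leq_div2r.
rewrite (eq_bigr (fun q => (2^-1 : R) ^+ j * (2^-1) ^+ (q %/ m0))); last first.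
  by move=> q _; rewrite divnMDl // exprD.
rewrite -mulr_sumr ler_wpM2l ?exprn_ge0 ?invr_ge0 //.
apply: (@le_trans _ _ (\sum_(0 <= q < m0 * Q) (2^-1 : R) ^+ (q %/ m0))).
  rewrite [leRHS](@big_cat_nat _ _ _ Q) //=; last exact: leq_pmull.
  by rewrite lerDl; apply: sumr_ge0 => q _; rewrite exprn_ge0 ?invr_ge0.
apply: le_trans (sum_le_block _ _ hh) _.
rewrite mulrC ler_wpM2r //.
rewrite (eq_bigr (fun q => (2^-1 : R) ^+ q)); last by move=> q _; rewrite mulKn.
have -> : \sum_(0 <= q < Q) (2^-1 : R) ^+ q = 2 - 2 * 2^-1 ^+ Q.
  elim: Q => [|Q IH]; first by rewrite big_geq // expr0 mulr1 subrr.
  by rewrite big_nat_recr //= IH exprS; lra.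
by rewrite gerBl mulr_ge0 // exprn_ge0 // invr_ge0.
Qed.

End BlockSums.

(** * Decay of hitting probabilities, and partial sums for k walks against those for one walk *)

Section Cover.
Context {R : realType} {G : sgraph}.
Hypothesis conn : connected_graph G.
Implicit Types (x y z : G) (A : {set G}).

Local Notation unc := (@uncovered R G).
Local Notation kunc := (@kuncovered R G).

(** Connectedness enters here: the walk follows a fixed path to z with positive probability. *)
Lemma hit_lt1 y z : exists m, unc m y (finset.set1 z) < 1.
Proof.
case/connectP: (conn y z) => s; elim: s y => [|x s IH] y /=.
  by move=> _ <-; exists 0%N; rewrite uncovered_hit.
case/andP=> yx xs zE; have [m hm] := IH _ xs zE; exists m.+1.
case: (eqVneq y z) => [->|yz]; first by rewrite uncovered_hit.
rewrite /uncovered /= set1_del // -(step_prob_sum (R := R) y) (bigD1 x) //= [ltRHS](bigD1 x) //=.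
apply: ltr_leD.
  by rewrite -[ltRHS]mulr1 ltr_pM2l // step_prob_adj.
apply: ler_sum => v _; rewrite -[leRHS]mulr1 ler_wpM2l ?step_prob_ge0 //.
by case/andP: (uncovered_prob (R := R) m v [set z]%SET).
Qed.

(** A qualitative bound from the finiteness of the graph, used to show that expected times are
    finite; an m0 of order h_max is chosen in [cover_time_approx]. *)
Lemma hit_half : exists2 m, (0 < m)%N & forall y z, unc m y (finset.set1 z) <= 2^-1.
Proof.
have [m hm] : exists m, forall y z, unc m y (finset.set1 z) < 1.
  pose m y z := projT1 (cid (hit_lt1 y z)).
  exists (\max_y \max_z m y z) => y z.
  apply: le_lt_trans (projT2 (cid (hit_lt1 y z))).
  apply: uncovered_antitone; rewrite -/(m y z).
  by apply: leq_trans (leq_bigmax y); exact: leq_bigmax.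
(* A maximum over finitely many pairs stays below 1, so some power of it is at most 1/2; by [hitD]
   the exponent counts blocks of m steps. *)
pose a := \big[Num.max/0]_y \big[Num.max/0]_z unc m y (finset.set1 z).
have ha y z : unc m y (finset.set1 z) <= a.
  by apply: le_trans (le_bigmax _ _ y); exact: (le_bigmax _ (fun z => unc m y [set z]%SET)).
have a0 : 0 <= a by exact: bigmax_ge_id.
have a1 : a < 1.
  by apply/bigmax_ltP; split => // y _; apply/bigmax_ltP; split.
have [j hj] : exists j, a ^+ j <= 2^-1.
  have /cvgrPdist_le /(_ 2^-1) : a ^+ n @[n --> \oo] --> (0 : R).
    by apply: cvg_expr; rewrite ger0_norm.
  case; first by rewrite invr_gt0.
  move=> N _ /(_ N (leqnn N)); rewrite sub0r normrN ger0_norm ?exprn_ge0 //.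
  by move=> h; exists N.
have hjm l y z : unc (l * m) y (finset.set1 z) <= a ^+ l.
  elim: l y z => [|l IH] y z.
    by case/andP: (uncovered_prob (R := R) (0 * m) y [set z]%SET).
  rewrite mulSn exprS; apply: le_trans (hitD m y (fun x => IH x z)) _.
  by rewrite ler_wpM2r // exprn_ge0.
exists (j * m).+1 => // y z; apply: le_trans hj; apply: le_trans (hjm j y z).
exact/uncovered_antitone.
Qed.

Lemma hit_geometric m0 m y z : (0 < m0)%N ->
  (forall y z, unc m0 y (finset.set1 z) <= 2^-1) ->
  unc m y (finset.set1 z) <= 2^-1 ^+ (m %/ m0).
Proof.
move=> m00 hm0.
have h l y' z' : unc (l * m0) y' (finset.set1 z') <= 2^-1 ^+ l.
  elim: l y' z' => [|l IH] y' z'.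
    by case/andP: (uncovered_prob (R := R) (0 * m0) y' [set z']%SET).
  rewrite mulSn exprS; apply: le_trans (hitD m0 y' (fun x => IH x z')) _.
  by rewrite ler_wpM2r // exprn_ge0 // invr_ge0.
by apply: le_trans (h _ _ _); apply: uncovered_antitone; exact: leq_trunc_div.
Qed.

Variables (m0 k L j : nat) (C : R).
Hypotheses (m0_gt0 : (0 < m0)%N) (k_gt0 : (0 < k)%N) (L_gt0 : (0 < L)%N).
Hypothesis m0_half : forall y z, unc m0 y (finset.set1 z) <= 2^-1.
Hypothesis k_le : (k <= 2 ^ j)%N.

Let al m : R := 2^-1 ^+ (m %/ m0).

Let unc_ge0 t x A : 0 <= unc t x A.
Proof. by case/andP: (uncovered_prob (R := R) t x A). Qed.

Let unc_le1 t x A : unc t x A <= 1.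
Proof. by case/andP: (uncovered_prob (R := R) t x A). Qed.

Let kunc_ge0 l t x A : 0 <= kunc l t x A.
Proof. by case/andP: (kuncovered_prob (R := R) l t x A). Qed.

Let kunc_le1 l t x A : kunc l t x A <= 1.
Proof. by case/andP: (kuncovered_prob (R := R) l t x A). Qed.

(** The fixed part j m0 of the margin pays for the factor k, since k 2^-j <= 1; the growing part q
    makes the errors summable. *)
Lemma margin_sum Q : \sum_(0 <= q < Q) k%:R * al (j * m0 + q) <= 2 * m0%:R.
Proof.
have kj : k%:R * 2^-1 ^+ j <= 1 :> R.
  by rewrite exprVn ler_pdivrMr ?exprn_gt0 // mul1r -natrX ler_nat.
have m2 : 0 <= 2 * m0%:R :> R by rewrite mulr_ge0.
rewrite -mulr_sumr; apply: le_trans (ler_wpM2l (ler0n _ k) (half_geometric_sum j Q m0_gt0)) _.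
have := ler_wpM2r m2 kj; rewrite mul1r => h; rewrite [k%:R * _]mulrA; exact: h.
Qed.

(** Time (L+1)q + j m0 splits into a margin j m0 + q and L q useful steps, matched with time k L q
    of the single walk. Blocks of length L+1 against blocks of length kL give the ratio (L+1)/(kL) =
    1/k + 1/(kL). *)
Lemma kuncovered_sum_le i A N :
  (forall n, \sum_(0 <= s < n) unc s i A <= C) ->
  \sum_(0 <= t < N) kunc k t i A <=
    C / k%:R + C / (k * L)%:R + (L.+1 * (j + 3) * m0)%:R.
Proof.
move=> hC.
have kL0 : 0 < (k * L)%:R :> R by rewrite ltr0n muln_gt0 k_gt0.
apply: (@le_trans _ _ (\sum_(0 <= t < j * m0 + L.+1 * N) kunc k t i A)).
  rewrite [leRHS](@big_cat_nat _ _ _ N) //=; last by rewrite mulSn addnCA leq_addr.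
  by rewrite lerDl; apply: sumr_ge0 => q _; exact: kunc_ge0.
rewrite (@big_cat_nat _ _ _ (j * m0)%N) ?leq_addr //=.
have h1 : \sum_(0 <= t < j * m0) kunc k t i A <= (j * m0)%:R.
  rewrite -[leRHS]mulr1 -sum_cst_nat.
  by apply: ler_sum_nat => t _; exact: kunc_le1.
have h2 : \sum_(j * m0 <= t < j * m0 + L.+1 * N) kunc k t i A <=
    L.+1%:R * (1 + C / (k * L)%:R + 2 * m0%:R).
  rewrite -{1}[(j * m0)%N]add0n big_addn addKn.
  apply: le_trans (sum_le_block _ _ _) _.
    by move=> t u tu; apply: kuncovered_antitone; rewrite leq_add2r.
  rewrite ler_wpM2l //.
  apply: (@le_trans _ _ (\sum_(0 <= q < N) (unc (k * L * q) i A + k%:R * al (j * m0 + q)))).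
    apply: ler_sum_nat => q _.
    have -> : (L.+1 * q + j * m0 = (j * m0 + q) + L * q)%N by rewrite mulSn addnC addnA.
    rewrite -mulnA; apply: kuncovered_le_uncovered => // x y; exact: hit_geometric.
  rewrite big_split /= lerD ?margin_sum //.
  (* The term q = 0 is bounded by 1; the others then have index [q.+1], as in a lower block sum. *)
  apply: (@le_trans _ _ (\sum_(0 <= q < N.+1) unc (k * L * q) i A)).
    by rewrite big_nat_recr //= lerDl unc_ge0.
  rewrite big_nat_recl //= lerD //.
  rewrite ler_pdivlMr // mulrC; apply: le_trans (hC (k * L * N)%N).
  by apply: block_le_sum => t u; exact: uncovered_antitone.
apply: le_trans (lerD h1 h2) _.
have -> : L.+1%:R * (1 + C / (k * L)%:R + 2 * m0%:R) =
    C / k%:R + C / (k * L)%:R + L.+1%:R * (1 + 2 * m0%:R).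
  by rewrite natrM; field; rewrite !pnatr_eq0 -!lt0n k_gt0 L_gt0.
rewrite addrCA lerD2l -[2]/(2%:R) -[1]/(1%:R) -natrM -natrD -natrM -natrD ler_nat.
nia.
Qed.

(** Blocks have length L for the k walks and k(L+1) for the single walk, because here it is the
    single walk that spends the margin. *)
Lemma kuncovered_sum_ge i A N : exists N',
  L%:R / (k * L.+1)%:R * (\sum_(0 <= s < N) unc s i A - (k * (L + j * m0))%:R)
    - (2 * L * m0)%:R
  <= \sum_(0 <= t < N') kunc k t i A.
Proof.
(* [c] is the time of the single walk matched with q = 0: k pieces, each with margin j m0 and L
   useful steps. *)
exists (L * N)%N; set c := (k * (L + j * m0))%N.
have kL0 : 0 < (k * L.+1)%:R :> R by rewrite ltr0n muln_gt0 k_gt0.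
apply: le_trans (block_le_sum _ _ _); last exact: kuncovered_antitone.
apply: (@le_trans _ _ (L%:R *
  (\sum_(0 <= q < N) unc (k * L.+1 * q + c) i A - 2 * m0%:R))); last first.
  rewrite ler_wpM2l //.
  apply: (@le_trans _ _ (\sum_(0 <= q < N) (unc (k * L.+1 * q + c) i A - k%:R * al (j * m0 + q)))).
    by rewrite big_split /= sumrN lerD2l lerN2 margin_sum.
  apply: ler_sum_nat => q _; rewrite lerBlDr.
  have -> : (k * L.+1 * q + c = k * ((j * m0 + q) + L * q.+1))%N by rewrite /c; nia.
  by apply: uncovered_le_kuncovered => x y; exact: hit_geometric.
have -> : (2 * L * m0)%:R = L%:R * (2 * m0%:R) :> R by rewrite !natrM; ring.
rewrite [leRHS]mulrBr lerD2r -mulrA ler_wpM2l // mulrC ler_pdivrMr //.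
have fh : {homo (fun t => unc (t + c) i A) : t u / (t <= u)%N >-> u <= t}.
  by move=> t u tu; apply: uncovered_antitone; rewrite leq_add2r.
rewrite mulrC; apply: le_trans _ (sum_le_block (k * L.+1) N fh).
rewrite lerBlDr.
(* Undoing the shift by [c] costs at most [c], each of the first [c] terms being at most 1. *)
apply: (@le_trans _ _ (\sum_(0 <= s < c + k * L.+1 * N) unc s i A)).
  rewrite [leRHS](@big_cat_nat _ _ _ N) //=; last by nia.
  by rewrite lerDl; apply: sumr_ge0 => q _; exact: unc_ge0.
rewrite (@big_cat_nat _ _ _ c) ?leq_addr //= addrC lerD //.
  by rewrite -{1}[c]add0n big_addn addKn.
rewrite -[leRHS]mulr1 -sum_cst_nat.
by apply: ler_sum_nat => t _; exact: unc_le1.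
Qed.

End Cover.

(** * The law of the uncovered set *)

Section FirstTime.
Context {R : realType}.
Local Open Scope ereal_scope.

Lemma nneseries_le (f : nat -> \bar R) (x : \bar R) :
  (forall t, 0 <= f t) -> (forall n, \sum_(0 <= t < n) f t <= x) ->
  \sum_(0 <= t <oo) f t <= x.
Proof.
move=> f0 fx; apply: lime_le; first exact: is_cvg_nneseries.
by apply: nearW => n; exact: fx.
Qed.

(** The times before the first occurrence are counted one by one; if there is none, the infimum of
    the empty set and the series of ones are both [+oo]. *)
Lemma first_timeE (p : nat -> Prop) :
  first_time p =
  \sum_(0 <= t <oo) ((`[< forall s, (s <= t)%N -> ~ p s >] : bool)%:R%:E : \bar R).
Proof.
pose b t := `[< forall s, (s <= t)%N -> ~ p s >].
have b0 t : 0 <= (b t)%:R%:E :> \bar R by rewrite lee_fin ler0n.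
apply/eqP; rewrite eq_le; apply/andP; split; last first.
  apply: le_ereal_inf_tmp => _ [t pt <-]; apply: nneseries_le => // n.
  rewrite sumEFin lee_fin -natr_sum ler_nat.
  apply: (@leq_trans (\sum_(0 <= s < n) (s < t))%N).
    apply: leq_sum => s _; case: ltnP => [_|ts]; first exact: leq_b1.
    by case: asboolP => // /(_ t ts).
  apply: (@leq_trans (minn n t)); last exact: geq_minr.
  elim: n => [|n IH]; first by rewrite big_geq.
  by rewrite big_nat_recr //=; move: IH; lia.
have [[t pt]|np] := pselect (exists t, p t).
  have exb : exists t, `[< p t >] by exists t; apply/asboolP.
  case: (ex_minnP exb) => t0 /asboolP pt0 mt0.
  apply: (@le_trans _ _ t0%:R%:E); first by apply: ereal_inf_lbound; exists t0.
  apply: (@le_trans _ _ (\sum_(0 <= t < t0) (b t)%:R%:E)); last first.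
    exact: nneseries_lim_ge.
  rewrite sumEFin lee_fin -natr_sum ler_nat.
  rewrite -{1}[t0]subn0 -[X in (X <= _)%N]muln1 -sum_nat_const_nat big_nat [leqRHS]big_nat.
  apply: leq_sum => s /andP[_ st]; rewrite lt0b; apply/asboolP => r rs pr.
  have := mt0 r (introT (asboolP _) pr).
  by rewrite leqNgt (leq_ltn_trans rs st).
suff -> : \sum_(0 <= t <oo) (b t)%:R%:E = +oo :> \bar R by rewrite leey.
apply/eqyP => A A0.
apply: (@le_trans _ _ (\sum_(0 <= t < (Num.truncn A).+1) (b t)%:R%:E)); last first.
  exact: nneseries_lim_ge.
rewrite sumEFin lee_fin -natr_sum (eq_bigr (fun=> 1%N)).
  by rewrite sum_nat_const_nat subn0 muln1 ltW // truncnS_gt.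
move=> s _; suff -> : b s by [].
by apply/asboolP => r _ pr; apply: np; exists r.
Qed.

Lemma integral_first_time d (Om : measurableType d) (P : probability Om R)
    (p : Om -> nat -> Prop) :
  (forall t, measurable [set o | forall s, (s <= t)%N -> ~ p o s]) ->
  \int[P]_o first_time (p o) =
  \sum_(0 <= t <oo) P [set o | forall s, (s <= t)%N -> ~ p o s].
Proof.
move=> mE; set E := fun t => [set o | forall s, (s <= t)%N -> ~ p o s].
rewrite (eq_integral (fun o => \sum_(0 <= t <oo) (\1_(E t) o)%:E)); last first.
  move=> o _; exact: first_timeE.
rewrite integral_nneseries //; last first.
  by move=> t; apply/measurable_EFinP/measurable_indic; exact: mE.
congr (limn _); apply/funext => n; apply: eq_bigr => t _.
by rewrite integral_indic ?classical_sets.setIT //; exact: mE.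
Qed.

End FirstTime.

(** * The k independent trajectories read as one concatenated sequence *)

Section Flatten.
Context {R : realType} {G : sgraph}.
Local Notation p := (@step_prob R G).

Lemma measure_split d (Om : measurableType d) (P : probability Om R)
    (Z : Om -> G) (E : set Om) :
  (forall y, measurable (E `&` Z @^-1` [set y])) ->
  measurable E /\ P E = (\sum_y P (E `&` Z @^-1` [set y]))%E.
Proof.
move=> mE.
have EE : E = \bigcup_(y in [set` enum G]) (E `&` Z @^-1` [set y]).
  apply/seteqP; split=> [ o Eo|o [y _ [Eo _]] //].
  by exists (Z o) => //=; rewrite mem_enum.
split; first by rewrite EE; apply: fin_bigcup_measurable => // y _; exact: mE.
rewrite {1}EE measure_fin_bigcup //; last first.
  by move=> y y' _ _ [ o [[_ /= <-] [_ /= <-]]].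
by rewrite -fsbig_seq ?enum_uniq // big_enum.
Qed.

Definition seen (w : nat -> G) c : {set G} :=
  [set v | [exists d : 'I_c, w d == v]]%SET.

Lemma seenP (w : nat -> G) c v :
  reflect (exists2 d, (d < c)%N & w d = v) (v \in seen w c).
Proof.
rewrite inE; apply: (iffP existsP) => [[d /eqP wd]|[d dc wd]]; first by exists d.
by exists (Ordinal dc); rewrite /= wd.
Qed.

Lemma seen_eq (w w' : nat -> G) c : (forall d, (d < c)%N -> w d = w' d) ->
  seen w c = seen w' c.
Proof.
move=> ww'; apply/setP => v; apply/seenP/seenP => -[d dc wd]; exists d => //;
  by rewrite -wd ww'.
Qed.

Lemma seenS (w : nat -> G) c : seen w c.+1 = (w c |: seen w c)%SET.
Proof.
apply/setP => v; rewrite in_setU1; apply/seenP/orP.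
  case=> d; rewrite ltnS leq_eqVlt => /orP[/eqP -> <-|dc wd]; first by left.
  by right; apply/seenP; exists d.
case=> [/eqP ->|/seenP[d dc wd]]; first by exists c.
by exists d => //; exact: ltnW.
Qed.

Lemma walk_law d (Om : measurableType d) (P : probability Om R)
    (X : nat -> Om -> G) (i : G) :
  simple_random_walk P X i -> forall (w : nat -> G) t, measurable (follows X w t) /\
  P (follows X w t) =
    ((w 0%N == i)%:R * \prod_(0 <= r < t) p (w r) (w r.+1))%:E.
Proof.
case=> mX X0 Xs w t.
have mF u : measurable (follows X w u).
  have -> : follows X w u = \bigcap_(s in `I_u.+1) (X s @^-1` [set w s]).
    by apply/seteqP; split=> o h s; [exact: h|move=> su; exact: h].
  by apply: fin_bigcap_measurable => // s _; exact: mX.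
split=> //; elim: t => [|t IH].
  rewrite big_geq // mulr1.
  have -> : follows X w 0 = X 0%N @^-1` [set w 0%N].
    apply/seteqP; split=> o; first exact.
    by move=> h s; rewrite leqn0 => /eqP ->.
  case: eqP => [-> //|w0]; apply/eqP; rewrite eq_le measure_ge0 andbT.
  have P0 : P (~` (X 0%N @^-1` [set i])) = 0%E.
    by rewrite probability_setC // X0 subee.
  rewrite -[leRHS]/0%E -P0; apply: le_measure; rewrite ?inE; [exact: mX|exact: measurableC|].
  by move=> o /= -> ; exact: w0.
by rewrite Xs IH big_nat_recr //= mulrA EFinM.
Qed.

Variables (k : nat) (i : G) (W : kwalks R k i) (t : nat).

Local Notation P := (kw_prob W).
Local Notation K := (k * t.+1)%N.

(** Each trajectory contributes t+1 positions; the default [i] concerns only the indices d >= K. *)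
Let flat_pos (d : nat) o : G :=
  if insub (d %/ t.+1)%N is Some j then kw_pos W j (d %% t.+1)%N o else i.

(** At multiples of t+1 a new trajectory starts at i, whatever position was read last. *)
Let flat_step (d : nat) x y : R := if (d %% t.+1 == 0)%N then (y == i)%:R else p x y.

(* [flat_value n x A]: n positions of the concatenation of the k trajectories
   are still to be read, x is the last one that was read. *)
Let flat_value := fix flat_value (n : nat) (x : G) (A : {set G}) : R :=
  if n is n'.+1 then
    \sum_y flat_step (K - n) x y * flat_value n' y (A :\ y)%SET
  else pending A.

Let flat_event (A : {set G}) (c : nat) (w : nat -> G) : set (kw_space W) :=
  [set o | (forall d, (d < c)%N -> flat_pos d o = w d) /\
           (A :\: seen (flat_pos^~ o) K)%SET != finset.set0].

(** At d = 0 the predecessor is [w 0] itself, which is harmless because [flat_step] ignores it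
    there. *)
Let flat_weight (c : nat) (w : nat -> G) : R :=
  \prod_(0 <= d < c) flat_step d (w d.-1) (w d).

Let flat_posE (j : 'I_k) s o : (s <= t)%N ->
  flat_pos (j * t.+1 + s) o = kw_pos W j s o.
Proof.
move=> st; rewrite /flat_pos divnMDl // (divn_small (m := s)) // addn0 valK.
by rewrite modnMDl modn_small.
Qed.

Let flat_law w : measurable [set o | forall d, (d < K)%N -> flat_pos d o = w d] /\
  P [set o | forall d, (d < K)%N -> flat_pos d o = w d] = (flat_weight K w)%:E.
Proof.
pose w' (j : 'I_k) s := w (j * t.+1 + s)%N.
have -> : [set o | forall d, (d < K)%N -> flat_pos d o = w d] =
    \bigcap_(j in [set: 'I_k]) follows (kw_pos W j) (w' j) t.
  apply/seteqP; split=> o h.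
    move=> j _ s st; rewrite -flat_posE //; apply: h.
    by rewrite (@leq_trans (j.+1 * t.+1)%N) ?leq_pmul2r // mulSnr ltn_add2l.
  move=> c cK; have jk : (c %/ t.+1 < k)%N by rewrite ltn_divLR.
  have := h (Ordinal jk) I (c %% t.+1)%N; rewrite /w' /= -divn_eq => <-.
    by rewrite -flat_posE /= -?divn_eq // -ltnS ltn_pmod.
  by rewrite -ltnS ltn_pmod.
split.
  apply: fin_bigcap_measurable => [|j _]; last exact: (walk_law (kw_srw W j) _ _).1.
  exact: finite_finset.
rewrite kw_indep (eq_bigr (fun j : 'I_k => (\prod_(j * t.+1 <= d < j.+1 * t.+1)
    flat_step d (w d.-1) (w d))%:E)).
  by rewrite prodEFin /flat_weight big_nat_mul big_mkord.
move=> j _; rewrite (walk_law (kw_srw W j) _ _).2; congr EFin.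
rewrite -{1}[(j * t.+1)%N]add0n big_addn mulSn addnK big_nat_recl //.
rewrite {1}/flat_step add0n modnMl eqxx /w' addn0; congr (_ * _).
apply: eq_big_nat => s /andP[_ st].
rewrite (addnC s.+1) /flat_step modnMDl modn_small //.
by rewrite addnS.
Qed.

(** Backward induction from c = K: the event is split according to the value y of position c, and
    summing over y gives one more step of [flat_value]. *)
Let flat_event_law A c w : (c <= K)%N ->
  measurable (flat_event A c w) /\
  P (flat_event A c w) = (flat_weight c w *
    flat_value (K - c) (w c.-1) (A :\: seen w c)%SET)%:E.
Proof.
move=> cK; have [n Kn] : exists n, (K = c + n)%N by exists (K - c)%N; rewrite subnKC.
rewrite Kn addKn.
elim: n c w {cK} Kn => [|n IH] c w Kn.
  rewrite addn0 in Kn; subst c; have [mF PF] := flat_law w.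
  rewrite /= /pending; case: (eqVneq (A :\: seen w K)%SET finset.set0) => AK.
    have -> : flat_event A K w = set0.
      by apply/seteqP; split=> // o [h]; rewrite (seen_eq h) AK eqxx.
    by rewrite mulr0 measure0; split.
  have -> : flat_event A K w = [set o | forall d, (d < K)%N -> flat_pos d o = w d].
    by apply/seteqP; split=> [ o []//|o h]; split=> //; rewrite (seen_eq h).
  by rewrite mulr1.
pose w_ y d := if d == c then y else w d.
have wE y d : (d < c)%N -> w_ y d = w d by move=> dc; rewrite /w_ ltn_eqF.
have EE y : flat_event A c w `&` (flat_pos c) @^-1` [set y] =
    flat_event A c.+1 (w_ y).
  apply/seteqP; split=> o [].
    move=> [h1 h2] h3; split=> // d; rewrite ltnS leq_eqVlt => /orP[/eqP ->|dc].
      by rewrite /w_ eqxx.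
    by rewrite wE // h1.
  move=> h1 h2; split; last by rewrite /= h1 // /w_ eqxx.
  by split=> // d dc; rewrite h1 ?wE // ltnW.
have Kn' : (K = c.+1 + n)%N by rewrite addSnnS.
have [] := @measure_split _ _ P (flat_pos c) (flat_event A c w).
  by move=> y; rewrite EE; exact: (IH _ _ Kn').1.
move=> mE ->; split=> //.
rewrite (eq_bigr (fun y => (flat_weight c w * (flat_step c (w c.-1) y *
    flat_value n y ((A :\: seen w c) :\ y)%SET))%:E)).
  by rewrite sumEFin -mulr_sumr /= Kn addnK.
move=> y _; rewrite EE (IH _ _ Kn').2 /flat_weight big_nat_recr //= -mulrA.
congr (_ * (_ * _))%:E.
- apply: eq_big_nat => d /andP[_ dc]; rewrite !wE //.
  by apply: leq_ltn_trans dc; exact: leq_pred.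
- rewrite [in w_ y c]/w_ eqxx; case: c w w_ wE {Kn Kn' EE mE IH} => [|c] w w_ wE.
    by rewrite /flat_step mod0n eqxx.
  by rewrite wE.
- rewrite [in w_ y c]/w_ eqxx; congr flat_value.
  rewrite seenS {1}/w_ eqxx (seen_eq (wE y)).
  by apply/setP => v; rewrite !inE negb_or andbA.
Qed.

(** Unread positions are grouped by trajectory. [flat_value] deletes a vertex on reading it,
    [evolve] on leaving it, hence the [B :\ y] on one side of [H]. *)
Let flat_valueE l x A : (l <= k)%N ->
  flat_value (l * t.+1) x A = kuncovered l t i A.
Proof.
elim: l x A => [//|l IH] x A lk.
have lt_lk : (l * t.+1 + t < K)%N.
  by rewrite (@leq_trans (l.+1 * t.+1)%N) ?leq_pmul2r // mulSn addnC addSn.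
have H s : (s <= t)%N -> forall y B,
    flat_value (l * t.+1 + s) y (B :\ y)%SET =
    evolve s (after (kuncovered l t i)) y B.
  elim: s => [|s IHs] st y B; first by rewrite addn0 /= IH // ltnW.
  rewrite addnS /=; apply: eq_bigr => z _; rewrite IHs ?(ltnW st) // /flat_step.
  (* The index being read is t - s modulo t+1, nonzero for s < t: no restart inside a trajectory. *)
  have -> : (K - (l * t.+1 + s).+1 = (k - l.+1) * t.+1 + (t - s))%N by nia.
  rewrite modnMDl modn_small; last by lia.
  by rewrite subn_eq0 leqNgt st.
rewrite mulSn addSn addnC /= (bigD1 i) //=.
have -> : (K - (l * t.+1 + t).+1 = (k - l.+1) * t.+1)%N by nia.
rewrite /flat_step modnMl eqxx eqxx mul1r H // big1 ?addr0 // => y /negbTE yi.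
by rewrite yi mul0r.
Qed.

Lemma kwalks_uncovered (A : {set G}) :
  measurable [set o | ~ forall v, v \in A -> exists j s, (s <= t)%N /\ kw_pos W j s o = v] /\
  P [set o | ~ forall v, v \in A -> exists j s, (s <= t)%N /\ kw_pos W j s o = v] =
  (kuncovered k t i A)%:E.
Proof.
have -> : [set o | ~ forall v, v \in A -> exists j s, (s <= t)%N /\ kw_pos W j s o = v] =
    flat_event A 0 (fun=> i).
  apply/seteqP; split=> o.
    move=> h; split=> //; apply/negP => /eqP A0; apply: h => v vA.
    have : v \in seen (flat_pos^~ o) K.
      apply/negPn/negP => vs; have : v \in (A :\: seen (flat_pos^~ o) K)%SET.
        by rewrite finset.in_setD vs.
      by rewrite A0 inE.
    case/seenP => d dK <-; have jk : (d %/ t.+1 < k)%N by rewrite ltn_divLR.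
    exists (Ordinal jk), (d %% t.+1)%N; have dt : (d %% t.+1 <= t)%N by rewrite -ltnS ltn_pmod.
    by split=> //; rewrite -flat_posE //= -divn_eq.
  move=> [_ /set0Pn[v]]; rewrite finset.in_setD => /andP[vs vA] h.
  have [j [s [st vE]]] := h v vA; case/negP: vs; apply/seenP.
  exists (j * t.+1 + s)%N; last by rewrite flat_posE.
  by rewrite (@leq_trans (j.+1 * t.+1)%N) ?leq_pmul2r // mulSnr ltn_add2l.
have [mE ->] := flat_event_law A (fun=> i) (leq0n K).
split=> //; rewrite /flat_weight big_geq // mul1r subn0 flat_valueE //.
congr (kuncovered _ _ _ _)%:E; apply/setP => v; rewrite finset.in_setD.
by case: seenP => // -[].
Qed.

End Flatten.

(** * Cover times *)

Section ExpectedTimes.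
Context {R : realType} {G : sgraph}.

Lemma expected_cover_timeE k (i : G) (W : kwalks R k i) :
  expected_cover_time W =
  (\sum_(0 <= t <oo) (kuncovered k t i (finset.setTfor G))%:E)%E.
Proof.
have E t : [set o | forall s, (s <= t)%N -> ~ covered o s] =
    [set o | ~ forall v, v \in finset.setTfor G -> exists j s, (s <= t)%N /\ kw_pos W j s o = v].
  apply/seteqP; split=> o /= h.
    by move=> c; apply: (h t (leqnn t)) => v; apply: c; rewrite inE.
  move=> s st c; apply: h => v _; have [j [u [us uv]]] := c v.
  by exists j, u; split=> //; exact: leq_trans us st.
rewrite /expected_cover_time integral_first_time => [|t]; last first.
  by rewrite E; exact: (kwalks_uncovered _ _ _).1.
congr (limn _); apply/funext => n; apply: eq_bigr => t _.
by rewrite E; exact: (kwalks_uncovered _ _ _).2.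
Qed.

(** Hitting v is covering the singleton of v, and [kuncovered 1] computes to [uncovered]. *)
Lemma hitting_timeE (i : G) (W : kwalks R 1 i) (v : G) :
  hitting_time W v = (\sum_(0 <= t <oo) (uncovered t i (finset.set1 v))%:E)%E.
Proof.
have E t : [set o | forall s, (s <= t)%N -> ~ kw_pos W ord0 s o = v] =
    [set o | ~ forall x, x \in finset.set1 v -> exists j s, (s <= t)%N /\ kw_pos W j s o = x].
  apply/seteqP; split=> o /= h.
    move=> c; have [|j [s [st sv]]] := c v; first by rewrite inE.
    by apply: (h s st); rewrite -sv (ord1 j).
  move=> s st c; apply: h => x; rewrite inE => /eqP ->.
  by exists ord0, s.
rewrite /hitting_time integral_first_time => [|t]; last first.
  by rewrite E; exact: (kwalks_uncovered _ _ _).1.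
congr (limn _); apply/funext => n; apply: eq_bigr => t _.
by rewrite E; exact: (kwalks_uncovered _ _ _).2.
Qed.

(** [fine] sends [+oo] to 0, so a uniform bound on the partial sums must come first; the same bound
    then serves as an upper estimate of the maximum. *)
Lemma fine_bigmax_series (I : finType) (f : I -> nat -> R) (B : R) :
  let M := (\big[maxe/0%E]_i \sum_(0 <= t <oo) (f i t)%:E)%E in
  (forall i t, 0 <= f i t) -> 0 <= B ->
  (forall i n, \sum_(0 <= t < n) f i t <= B) ->
  [/\ M = (fine M)%:E, fine M <= B, 0 <= fine M &
      forall i n, \sum_(0 <= t < n) f i t <= fine M].
Proof.
move=> M f0 B0 fB.
have MB : (M <= B%:E)%E.
  apply: bigmax_le => [|i _]; first by rewrite lee_fin.
  by apply: nneseries_le => [t|n]; rewrite ?sumEFin lee_fin.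
have M0 : (0 <= M)%E by exact: bigmax_ge_id.
have Mf : M \is a fin_num by rewrite ge0_fin_numE // (le_lt_trans MB) // ltry.
have ME : M = (fine M)%:E by rewrite fineK.
split=> //; [by rewrite -lee_fin -ME|by rewrite -lee_fin -ME|].
move=> i n; rewrite -lee_fin -ME -sumEFin.
apply: (@le_trans _ _ (\sum_(0 <= t <oo) (f i t)%:E)%E).
  by apply: nneseries_lim_ge => t _ _; rewrite lee_fin.
exact: (le_bigmax _ (fun i => \sum_(0 <= t <oo) (f i t)%:E)%E).
Qed.

End ExpectedTimes.

(** * Quantitative comparison of C^k with C/k on a fixed graph *)

Section CoverTimes.
Context {R : realType} {G : sgraph} (W : forall k (i : G), kwalks R k i).
Hypothesis conn : connected_graph G.

Let V : {set G} := finset.setTfor G.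

Let uncovered_ge0 t (x : G) A : 0 <= uncovered t x A :> R.
Proof. by case/andP: (uncovered_prob (R := R) t x A). Qed.

Let kuncovered_ge0 k t (x : G) A : 0 <= kuncovered k t x A :> R.
Proof. by case/andP: (kuncovered_prob (R := R) k t x A). Qed.

Lemma hit_sum_bounded : exists2 B : R, 0 <= B &
  forall (y z : G) n, \sum_(0 <= t < n) uncovered t y (finset.set1 z) <= B.
Proof.
have [m m0 hm] := @hit_half R G conn; exists (2 * m%:R); first by rewrite mulr_ge0.
move=> y z n; have := half_geometric_sum (R := R) 0 n m0; rewrite expr0 mul1r.
apply: le_trans; apply: ler_sum => q _; rewrite mul0n add0n.
exact: hit_geometric.
Qed.

Lemma max_hitting_time_ge (y z : G) n :
  \sum_(0 <= t < n) uncovered t y (finset.set1 z) <= max_hitting_time W.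
Proof.
have [B B0 hB] := hit_sum_bounded.
have E : max_hitting_time W = fine (\big[maxe/0%E]_(u : G * G)
    \sum_(0 <= t <oo) (uncovered t u.1 (finset.set1 u.2))%:E)%E.
  congr fine; rewrite pair_bigA_idem //=; last exact: maxxx.
  by apply: eq_bigr => u _; exact: hitting_timeE.
have [_ _ _ h] := @fine_bigmax_series R (G * G)%type
  (fun u t => uncovered t u.1 (finset.set1 u.2)) B (fun u t => uncovered_ge0 _ _ _) B0
  (fun u => hB u.1 u.2).
by rewrite E; exact: (h (y, z)).
Qed.

Lemma cover_time_spec k (B : R) : 0 <= B ->
  (forall (i : G) n, \sum_(0 <= t < n) kuncovered k t i V <= B) ->
  [/\ cover_time W k <= B, 0 <= cover_time W k &
      forall (i : G) n, \sum_(0 <= t < n) kuncovered k t i V <= cover_time W k].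
Proof.
move=> B0 hB; have E : cover_time W k = fine (\big[maxe/0%E]_(i : G)
    \sum_(0 <= t <oo) (kuncovered k t i V)%:E)%E.
  by congr fine; apply: eq_bigr => i _; exact: expected_cover_timeE.
rewrite E; by have [] := @fine_bigmax_series R G
  (fun i t => kuncovered k t i V) B (fun i t => kuncovered_ge0 _ _ _ _) B0 hB.
Qed.

Lemma cover_sum_bounded : exists2 B : R, 0 <= B &
  forall (i : G) n, \sum_(0 <= t < n) uncovered t i V <= B.
Proof.
have [B B0 hB] := hit_sum_bounded; exists (#|G|%:R * B); first by rewrite mulr_ge0.
move=> i n; apply: (@le_trans _ _ (\sum_(0 <= t < n) \sum_z uncovered t i (finset.set1 z))).
  apply: ler_sum => t _; apply: le_trans (uncovered_union t i V) _.
  by rewrite (eq_bigl xpredT) // => z; rewrite inE.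
rewrite exchange_big /= mulr_natl -sumr_const.
by apply: ler_sum => z _; exact: hB.
Qed.

Lemma cover_time1_spec :
  0 <= cover_time W 1 /\
  forall (i : G) n, \sum_(0 <= t < n) uncovered t i V <= cover_time W 1.
Proof.
have [B B0 hB] := cover_sum_bounded.
by have [_ ? ?] := cover_time_spec (k := 1) B0 hB.
Qed.

Lemma max_hitting_time_ge1 : (1 < #|G|)%N -> 1 <= max_hitting_time W.
Proof.
move=> /card_gt1P[y [z [_ _ yz]]].
apply: le_trans (max_hitting_time_ge y z 1); rewrite big_nat1 /uncovered /=.
rewrite /after /pending set1_del //.
by have -> : ([set z]%SET != finset.set0) by apply/set0Pn; exists z; rewrite inE.
Qed.

Lemma cover_time_approx k L j : (1 < #|G|)%N -> (0 < k)%N -> (0 < L)%N ->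
  (k <= 2 ^ j)%N ->
  `|cover_time W k - cover_time W 1 / k%:R| <=
  cover_time W 1 / k%:R / L%:R + (L.+1 * (j + 3))%:R * (3 * max_hitting_time W).
Proof.
move=> G2 k0 L0 kj; have H1 := max_hitting_time_ge1 G2.
set H := max_hitting_time W in H1 *.
(* Above 2H, as Markov's inequality requires, and at most 2H + 1 <= 3H since H >= 1. *)
pose m0 := (Num.truncn (2 * H)).+1.
have H0 : 0 <= 2 * H by lra.
have m0H : m0%:R <= 3 * H by rewrite /m0 -natr1; have /andP[+ _] := truncn_itv H0; lra.
have Hm0 : 2 * H < m0%:R by exact: truncnS_gt.
have half (y z : G) : uncovered m0 y (finset.set1 z) <= 2^-1 :> R.
  (* Markov's inequality: each of the first m0 tail probabilities is at least the one at m0. *)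
  have h : m0%:R * uncovered m0 y (finset.set1 z) <= H.
    apply: le_trans (max_hitting_time_ge y z m0); rewrite -sum_cst_nat.
    by apply: ler_sum_nat => s /andP[_ sm]; apply: uncovered_antitone; exact: ltnW.
  have m00 : 0 < m0%:R :> R by rewrite ltr0n.
  by rewrite -(ler_pM2l m00); lra.
have [C0 hC] := cover_time1_spec; set C := cover_time W 1 in C0 hC *.
have k0' : 0 < k%:R :> R by rewrite ltr0n.
have L0' : 0 < L%:R :> R by rewrite ltr0n.
have m00 : (0 < m0)%N by [].
have up i N := kuncovered_sum_le (C := C) m00 k0 L0 half kj (A := V) N (hC i).
have B0 : 0 <= C / k%:R + C / (k * L)%:R + (L.+1 * (j + 3) * m0)%:R.
  by rewrite !addr_ge0 // divr_ge0.
have [Cu Ck0 hCk] := cover_time_spec B0 up; set Ck := cover_time W k in Cu Ck0 hCk *.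
have err : (L.+1 * (j + 3) * m0)%:R <= (L.+1 * (j + 3))%:R * (3 * H).
  by rewrite natrM ler_wpM2l.
pose X : R := (L + j * m0)%:R; pose Y : R := (2 * L * m0)%:R.
have XY : X + Y <= (L.+1 * (j + 3) * m0)%:R by rewrite -natrD ler_nat; nia.
have X0 : 0 <= X by []. have Y0 : 0 <= Y by [].
(* The inequality of [kuncovered_sum_ge] solved for the sum of the single walk, with [Ck] bounding
   the sum of the k walks. *)
pose B := k%:R * (L.+1%:R / L%:R * (Ck + Y) + X).
have B'0 : 0 <= B by rewrite mulr_ge0 // addr_ge0 // mulr_ge0 ?divr_ge0 // addr_ge0.
have CB : C <= B.
  suff hB i n : \sum_(0 <= t < n) uncovered t i V <= B.
    by have [] := cover_time_spec (k := 1) B'0 hB.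
  have [N' h] := kuncovered_sum_ge m00 k0 L0 half kj i V n.
  have {}h := le_trans h (hCk i N').
  rewrite -/Y (natrM _ k (L + _)) -/X in h.
  set S := \sum_(0 <= t < n) _ in h *.
  rewrite lerBlDr mulrC mulrA ler_pdivrMr in h; last by rewrite ltr0n muln_gt0 k0.
  rewrite -ler_pdivlMr // in h.
  have -> : B = (Ck + Y) * (k * L.+1)%:R / L%:R + k%:R * X.
    by rewrite /B natrM; field; rewrite pnatr_eq0 -lt0n.
  by rewrite -lerBlDr.
rewrite natrM invfM mulrA in Cu.
(* Dividing [CB] by k and by 1 + 1/L, whose inverse is at least 1 - 1/L. *)
have low : C / k%:R - C / k%:R / L%:R - (X + Y) <= Ck.
  have : C / k%:R <= L.+1%:R / L%:R * (Ck + Y) + X by rewrite ler_pdivrMr // mulrC.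
  set a := C / k%:R; have a0 : 0 <= a by rewrite divr_ge0.
  have -> : L.+1%:R / L%:R * (Ck + Y) + X = (L.+1%:R * (Ck + Y) + L%:R * X) / L%:R.
    by field; rewrite pnatr_eq0 -lt0n.
  rewrite ler_pdivlMr //.
  have aE : a = a / L%:R * L%:R by rewrite divfK // pnatr_eq0 -lt0n.
  set b := a / L%:R in aE *; have b0 : 0 <= b by rewrite divr_ge0.
  rewrite aE -natr1; set l := L%:R in L0' *; move=> h.
  have l1 : 0 < l + 1 by lra.
  rewrite -(ler_pM2l l1); nra.
by rewrite ler_norml; apply/andP; split; lra.
Qed.

End CoverTimes.

(** * Growth of k log k against g *)

Section Asymptotics.
Context {R : realType}.

(** For k > 1, 2^j < k with j one less than the rounded-up logarithm, and ln x < x at x = k^eps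
    bounds j; the 4 is 3 plus this rounding. *)
Lemma up_log_le_powR (eps : R) : 0 < eps -> exists2 c : R, 0 < c &
  forall k, (0 < k)%N -> (up_log 2 k + 3)%:R <= c * k%:R `^ eps.
Proof.
move=> e0; have ln20 : 0 < ln (2 : R) by rewrite ln_gt0 // ltr1n.
have el0 : 0 < eps * ln 2 by rewrite mulr_gt0.
exists (4 + (eps * ln 2)^-1); first by rewrite addr_gt0 // invr_gt0.
move=> k k0; have k1 : 1 <= k%:R :> R by rewrite ler1n.
have p0 : 0 < k%:R `^ eps :> R by rewrite powR_gt0 // ltr0n.
have p1 : 1 <= k%:R `^ eps :> R.
  by rewrite -[leLHS](powRr0 k%:R); apply: ler_powR => //; exact: ltW.
have i0 : 0 < (eps * ln 2)^-1 by rewrite invr_gt0.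
have [k_le1|k_gt1] := leqP k 1.
  have -> : up_log 2 k = 0%N by apply/eqP; rewrite up_log_eq0 k_le1 orbT.
  rewrite add0n; nra.
have lt_k := up_log_gtn (isT : (1 < 2)%N) k_gt1.
have j0 : (0 < up_log 2 k)%N by rewrite up_log_gt0 k_gt1.
rewrite -(prednK j0) in lt_k *; set j := (up_log 2 k).-1 in lt_k *.
have jln : j%:R * ln 2 <= ln (k%:R : R).
  rewrite mulr_natl -lnXn // ler_ln ?posrE ?exprn_gt0 ?ltr0n //.
  by rewrite -natrX ler_nat ltnW.
have lnk : eps * ln (k%:R : R) < k%:R `^ eps by rewrite -ln_powR; exact: ln_sublinear.
have h : j%:R <= (eps * ln 2)^-1 * k%:R `^ eps.
  rewrite mulrC ler_pdivlMr //; nra.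
rewrite (_ : (j.+1 + 3)%:R = j%:R + 4 :> R); last by rewrite -addn1 -addnA natrD.
rewrite mulrDl; lra.
Qed.

(** Up to constants, k log k <= k^(1+eps) <= g^((1-eps)(1+eps)) = g^(1-eps^2), so the ratio is of
    order at most g^(-eps^2). *)
Lemma log_ratio_cvg0 (g : nat -> R) (k : nat -> nat) (eps M : R) :
  g n @[n --> \oo] --> +oo -> (forall n, (0 < k n)%N) -> 0 < eps -> eps < 1 ->
  (\forall n \near \oo, (k n)%:R <= M * g n `^ (1 - eps)) ->
  (up_log 2 (k n) + 3)%:R * (k n)%:R / g n @[n --> \oo] --> (0 : R).
Proof.
move=> goo k0 e0 e1 kM; have [c c0 hc] := up_log_le_powR e0.
pose M' := Num.max M 1; have M0 : 0 < M' by rewrite lt_max ltr01 orbT.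
have A0 : 0 < c * M' `^ (1 + eps) by rewrite mulr_gt0 // powR_gt0.
have ee0 : 0 < eps * eps by rewrite mulr_gt0.
apply/cvgrPdist_le => d d0.
(* The threshold for g beyond which g^(eps^2) absorbs the constants and 1/d. *)
pose K := (c * M' `^ (1 + eps) / d) `^ (eps * eps)^-1.
have K0 : 0 <= K by exact: powR_ge0.
near=> n.
have g1 : 1 <= g n by near: n; move/cvgryPge : goo; exact.
have gK : K <= g n by near: n; move/cvgryPge : goo; exact.
have kn : (k n)%:R <= M * g n `^ (1 - eps) by near: n.
have g0 : 0 < g n by exact: lt_le_trans ltr01 g1.
have kn' : (k n)%:R <= M' * g n `^ (1 - eps).
  by apply: le_trans kn _; apply: ler_wpM2r; rewrite ?powR_ge0 // le_max lexx.
rewrite sub0r normrN ger0_norm; last by rewrite divr_ge0 ?mulr_ge0 // ltW.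
have kn0 : 0 < (k n)%:R :> R by rewrite ltr0n.
have h1 : (up_log 2 (k n) + 3)%:R * (k n)%:R <= c * (k n)%:R `^ (1 + eps).
  rewrite addrC powRD; last by rewrite (gt_eqF kn0) implybT.
  by rewrite (powRr1 (ltW kn0)) mulrA ler_wpM2r ?hc // ltW.
have h2 : (k n)%:R `^ (1 + eps) <= M' `^ (1 + eps) * g n `^ (1 - eps * eps).
  have -> : 1 - eps * eps = (1 - eps) * (1 + eps) by ring.
  rewrite (powRrM (g n)) -(powRM _ (ltW M0) (powR_ge0 _ _)).
  apply: ge0_ler_powR => //; rewrite ?nnegrE ?mulr_ge0 ?powR_ge0 ?ltW //.
  by rewrite addr_gt0.
have h3 : c * M' `^ (1 + eps) / d <= g n `^ (eps * eps).
  have -> : c * M' `^ (1 + eps) / d = K `^ (eps * eps).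
    by rewrite -powRrM mulVf ?gt_eqF // powRr1 // divr_ge0 // ltW.
  by apply: ge0_ler_powR => //; rewrite ?nnegrE ?ltW.
have gE : g n = g n `^ (1 - eps * eps) * g n `^ (eps * eps).
  by rewrite -powRD ?subrK ?powRr1 ?ltW // gt_eqF // implybT.
have p0 : 0 < g n `^ (1 - eps * eps) by rewrite powR_gt0.
rewrite ler_pdivrMr // in h3.
rewrite ler_pdivrMr // [X in _ <= d * X]gE.
apply: le_trans h1 _; apply: (@le_trans _ _ (c * (M' `^ (1 + eps) * g n `^ (1 - eps * eps)))).
  by rewrite ler_wpM2l // ltW.
by rewrite mulrA [leRHS]mulrCA [leLHS]mulrC ler_wpM2l ?(ltW p0) // [leRHS]mulrC.
Unshelve. all: by end_near. Qed.

End Asymptotics.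

Theorem theorem5 (R : realType) (G : nat -> sgraph)
    (W : forall (n m : nat) (i : G n), kwalks R m i)
    (k : nat -> nat) (eps : R)
    (card_G : forall n, #|G n| = n)
    (conn_G : forall n, connected_graph (G n))
    (g_infty : cover_time (W n) 1 / max_hitting_time (W n) @[n --> \oo] --> +oo)
    (k_ge1 : forall n, (1 <= k n)%N)
    (eps_gt0 : 0 < eps) (eps_lt1 : eps < 1)
    (k_bigO : exists M : R, \forall n \near \oo,
       (k n)%:R <= M * (cover_time (W n) 1 / max_hitting_time (W n)) `^ (1 - eps)) :
  (exists2 r : nat -> R,
     little_o r (fun n => cover_time (W n) 1 / (k n)%:R) &
     forall n, cover_time (W n) (k n) = cover_time (W n) 1 / (k n)%:R + r n) /\
  (exists2 r : nat -> R,
     little_o r (fun n => (k n)%:R) &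
     forall n, speedup (W n) (k n) >= (k n)%:R - r n).
Proof.
pose C n := cover_time (W n) 1; pose Ck n := cover_time (W n) (k n).
pose H n := max_hitting_time (W n).
case: k_bigO => M kM.
have e_cvg := log_ratio_cvg0 g_infty k_ge1 eps_gt0 eps_lt1 kM.
(* The relative error; both conclusions follow from its convergence to 0. *)
pose rho n := (Ck n - C n / (k n)%:R) / (C n / (k n)%:R).
have k0 n : 0 < (k n)%:R :> R by rewrite ltr0n k_ge1.
have C_gt0 : \forall n \near \oo, 0 < C n.
  near=> n; have n2 : (1 < #|G n|)%N by rewrite card_G; near: n; exists 2%N.
  have H1 : 1 <= H n by exact: max_hitting_time_ge1.
  have : 1 <= C n / H n by near: n; move/cvgryPge : g_infty; exact.
  by rewrite ler_pdivlMr ?(lt_le_trans ltr01 H1) // mul1r => /(le_trans H1) /(lt_le_trans ltr01).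
have rho0 : rho n @[n --> \oo] --> (0 : R).
  apply/cvgrPdist_le => d d0.
  (* [L] depends on d but not on n: the term C/(kL) takes one half of d, and the hitting-time term,
     with [L] fixed, takes the other half for large n. *)
  pose L := (Num.truncn (2 / d)).+1.
  have L0 : 0 < L%:R :> R by [].
  have Ld : L%:R^-1 <= d / 2 :> R.
    by rewrite -[leRHS]invf_div lef_pV2 ?posrE ?divr_gt0 // ltW // truncnS_gt.
  pose b : R := L.+1%:R * 3; have b0 : 0 < b by rewrite mulr_gt0.
  near=> n.
  have n2 : (1 < #|G n|)%N by rewrite card_G; near: n; exists 2%N.
  have H1 : 1 <= H n by exact: max_hitting_time_ge1.
  have Cn0 : 0 < C n by near: n.
  have H0 : 0 < H n by exact: lt_le_trans H1.
  have e_le : (up_log 2 (k n) + 3)%:R * (k n)%:R / (C n / H n) <= d / 2 / b.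
    near: n; have /cvgrPdist_le /(_ (d / 2 / b)) := e_cvg.
    case; first by rewrite !divr_gt0.
    move=> N _ hN; exists N => // m /= Nm; have := hN m Nm.
    by rewrite sub0r normrN; apply: le_trans; exact: ler_norm.
  have a0 : 0 < C n / (k n)%:R by rewrite divr_gt0.
  have := cover_time_approx (W n) (conn_G n) n2 (k_ge1 n) (isT : (0 < L)%N)
    (up_logP (k n) (isT : (1 < 2)%N)).
  rewrite -/(C n) -/(Ck n) -/(H n) => happ.
  rewrite sub0r normrN /rho normrM normfV (gtr0_norm a0) ler_pdivrMr //.
  apply: le_trans happ _.
  have -> : d * (C n / (k n)%:R) = C n / (k n)%:R * (d / 2) + d / 2 * (C n / (k n)%:R).
    by field; rewrite gt_eqF.
  apply: lerD; first by rewrite ler_wpM2l // ltW.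
  (* Relative to C/k, this error is exactly [b] times the quantity that [e_cvg] sends to 0. *)
  have -> : (L.+1 * (up_log 2 (k n) + 3))%:R * (3 * H n) =
     (up_log 2 (k n) + 3)%:R * (k n)%:R / (C n / H n) * b * (C n / (k n)%:R).
    by rewrite /b natrM; field; rewrite !gt_eqF.
  by rewrite ler_wpM2r ?(ltW a0) // -ler_pdivlMr.
split.
  exists (fun n => Ck n - C n / (k n)%:R); first exact: rho0.
  by move=> n; rewrite addrC subrK.
(* With this remainder the bound is an equality, and the remainder divided by k is rho/(1 + rho). *)
exists (fun n => (k n)%:R - speedup (W n) (k n)); last by move=> n; rewrite opprB addrC subrK.
rewrite /little_o; apply/cvgrPdist_le => d d0; near=> n.
have Cn0 : 0 < C n by near: n.
(* Keeps the denominator 1 + rho at least 1/2, so that |rho| <= d/2 suffices for the quotient. *)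
have rho_half : `|rho n| <= 2^-1.
  near: n; move/cvgrPdist_le : rho0 => /(_ 2^-1); case; first by rewrite invr_gt0.
  by move=> N _ hN; exists N => // m /hN; rewrite /= sub0r normrN.
have rho_d : `|rho n| <= d / 2.
  near: n; move/cvgrPdist_le : rho0 => /(_ (d / 2)); case; first by rewrite divr_gt0.
  by move=> N _ hN; exists N => // m /hN; rewrite /= sub0r normrN.
have r1 : 2^-1 <= 1 + rho n by move: rho_half; rewrite ler_norml => /andP[]; lra.
have r1_gt0 : 0 < 1 + rho n by apply: lt_le_trans r1; rewrite invr_gt0.
have CkE : Ck n = C n / (k n)%:R * (1 + rho n).
  by rewrite /rho; field; rewrite !gt_eqF.
have -> : ((k n)%:R - speedup (W n) (k n)) / (k n)%:R = rho n / (1 + rho n).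
  rewrite /speedup -/(C n) -/(Ck n) CkE; field.
  by rewrite !gt_eqF.
rewrite sub0r normrN normrM normfV (gtr0_norm r1_gt0) ler_pdivrMr //.
by apply: le_trans rho_d _; nra.
Unshelve. all: by end_near. Qed.
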